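(* For any constant $r$ there exists a distribution over $r$-uniform hypergraphs on $n$ vertices such that: (1) any algorithm solving $r$-dimensional simplex enumeration with sufficiently large constant probability requires $\Omega(n^{r-2+1/(r+1)}/\log n)$ rounds in the CLIQUE model, and (2) any algorithm solving triangle enumeration with sufficiently large constant probability requires $\Omega(n^{r-5/3}/\log n)$ rounds in the CLIQUE model. These bounds apply a fortiori to the PRIMAL CONGEST (PC) model as well.
   Context: A hypergraph $H=(V,E)$ has vertex set $V$, $|V|=n$, and a set $E$ of nonempty subsets of $V$; it is $r$-uniform if every edge has exactly $r$ vertices. An $r$-dimensional simplex is a set of $r+1$ vertices all of whose $r$-element subsets are edges. A triangle is a simple cycle of length three $(v_0,e_0,v_1,e_1,v_2,e_2)$: $v_0,v_1,v_2\in V$ distinct, $e_0,e_1,e_2\in E$ distinct, and $v_i\in e_{i-1}\cap e_i$ (indices mod $3$); it is induced if moreover $v_i\notin e_{i+1}$ for each $i$. In the simplex (respectively triangle) enumeration problem each vertex $v$ outputs a set of simplices (triangles) such that these sets are pairwise disjoint and their union is the set of all simplices (triangles) of $H$; the triangle result applies both to enumerating all triangles and to enumerating all induced triangles. Computation: vertices are nodes with unique $O(\log n)$-bit IDs; synchronous rounds with unbounded local computation; algorithms may be randomized; initially each vertex knows its own ID and its incident edges, including the IDs of all vertices in them ($\mathrm{KT}_1$). With $B=\Theta(\log n)$: in CLIQUE, in each round each vertex may send a distinct $B$-bit message to every other vertex of $V$; in PC, in each round each vertex $v$ may send a distinct $B$-bit message to each vertex sharing an edge with $v$ (one message per such vertex).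 *)

(* Defs.v *)
From HB Require Import structures.
From mathcomp Require Import all_boot all_order all_algebra.
From mathcomp Require Import all_classical all_reals all_analysis.
From mathcomp Require Import fintype finset.
Set Implicit Arguments.
Unset Strict Implicit.
Unset Printing Implicit Defensive.
Import Order.TTheory GRing.Theory Num.Theory.
Import numFieldNormedType.Exports.
Local Open Scope ring_scope.

Record hypergraph (V : finType) := Hypergraph {
  edges :> {set {set V}};
  edges_nonempty : set0 \notin edges }.

HB.instance Definition _ (V : finType) := [isSub for @edges V].
HB.instance Definition _ (V : finType) := [Finite of hypergraph V by <:].

Definition uniform (V : finType) (r : nat) (H : hypergraph V) : bool :=
  [forall e in edges H, #|e| == r].

Definition is_simplex (V : finType) (r : nat) (H : hypergraph V)
    (S : {set V}) : bool :=
  (#|S| == r.+1) &&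
  [forall e : {set V}, (e \subset S) && (#|e| == r) ==> (e \in edges H)].

Definition simplices (V : finType) (r : nat) (H : hypergraph V) : {set {set V}} :=
  [set S | is_simplex r H S]%SET.

(* The sequence (v_0, e_0, v_1, e_1, v_2, e_2), as the pair of the functions
   i |-> v_i and i |-> e_i. The six sequences that traverse the same cycle are
   distinct elements of this type. *)
Definition cycle3 (V : finType) : finType :=
  ({ffun 'I_3 -> V} * {ffun 'I_3 -> {set V}})%type.

(* Additions and subtractions on 'I_3 are modulo 3. *)
Definition is_triangle (V : finType) (H : hypergraph V) (t : cycle3 V) : bool :=
  [&& injectiveb t.1, injectiveb t.2,
      [forall i : 'I_3, t.2 i \in edges H] &
      [forall i : 'I_3, t.1 i \in t.2 (i - 1) :&: t.2 i]].

Definition is_induced_triangle (V : finType) (H : hypergraph V)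
    (t : cycle3 V) : bool :=
  is_triangle H t && [forall i : 'I_3, t.1 i \notin t.2 (i + 1)].

Definition triangles (V : finType) (H : hypergraph V) : {set cycle3 V} :=
  [set t | is_triangle H t]%SET.

Definition induced_triangles (V : finType) (H : hypergraph V) : {set cycle3 V} :=
  [set t | is_induced_triangle H t]%SET.

Record fdist (R : realType) (T : finType) := FDist {
  pmf :> T -> R;
  pmf_ge0 : forall x, 0 <= pmf x;
  pmf_sum1 : \sum_x pmf x = 1 }.

Variant model := CLIQUE | PC.

Definition link (M : model) (V : finType) (H : hypergraph V) (u v : V) : bool :=
  match M with
  | CLIQUE => u != v
  | PC => (u != v) && [exists e in edges H, (u \in e) && (v \in e)]
  end.

Definition incident (V : finType) (H : hypergraph V) (v : V) : {set {set V}} :=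
  [set e in edges H | v \in e]%SET.

(* What a vertex receives in one round, indexed by the sender; None stands for
   the absence of a message. *)
Definition inbox (V : finType) (B : nat) : Type :=
  {ffun V -> option (B.-tuple bool)}.

(* A vertex is identified with its ID. In every round a vertex decides what to
   send, and after the last round what to output, from its ID, its incident
   edges, its private coins and the inboxes of the previous rounds. The coins
   range over an arbitrary finite probability space. Local computation is
   unrestricted. *)
Record algorithm (R : realType) (V : finType) (B : nat) (O : finType) :=
  Algorithm {
    rounds : nat;
    coins : finType;
    coins_law : V -> fdist R coins;
    send : V -> {set {set V}} -> coins -> seq (inbox V B) ->
           V -> option (B.-tuple bool);
    output : V -> {set {set V}} -> coins -> seq (inbox V B) -> {set O} }.

Section Execution.
Variables (R : realType) (V : finType) (B : nat) (O : finType).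
Variables (M : model) (A : algorithm R V B O) (H : hypergraph V).
Variable w : {ffun V -> coins A}.

Fixpoint received (t : nat) (v : V) : seq (inbox V B) :=
  if t is t'.+1 then
    rcons (received t' v)
      [ffun u => if link M H u v
                 then send u (incident H u) (w u) (received t' u) v
                 else None]
  else [::].

Definition outcome (v : V) : {set O} :=
  output v (incident H v) (w v) (received (rounds A) v).

Definition enumerates (target : {set O}) : bool :=
  [forall u : V, forall v : V, (u != v) ==> [disjoint outcome u & outcome v]]
  && (\bigcup_(v : V) outcome v == target)%SET.

End Execution.

(* The input is drawn from D and the coins of the vertices are independent of
   it and of each other. *)
Definition success_prob (R : realType) (V : finType) (B : nat) (O : finType)
    (M : model) (A : algorithm R V B O) (D : fdist R (hypergraph V))
    (target : hypergraph V -> {set O}) : R :=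
  \sum_(H : hypergraph V)
    \sum_(w : {ffun V -> coins A} | enumerates M H w (target H))
      D H * \prod_(v : V) coins_law A v (w v).

(* Omega(f) rounds, with a constant that is uniform over all algorithms. *)
Definition requires_rounds (R : realType) (M : model) (B : nat -> nat)
    (D : forall n, fdist R (hypergraph 'I_n)) (p : R) (O : nat -> finType)
    (target : forall n, hypergraph 'I_n -> {set O n}) (f : nat -> R) : Prop :=
  exists2 c : R, 0 < c &
    \forall n \near \oo%classic, forall A : algorithm R 'I_n (B n) (O n),
      p <= success_prob M A (D n) (@target n) -> c * f n <= (rounds A)%:R.

(* Main.v *)
Require Import Defs.
From mathcomp Require Import all_boot all_order all_algebra.
From mathcomp Require Import all_classical all_reals all_analysis.
From mathcomp Require Import fintype finset.
From mathcomp Require Import zify ring lra.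
Import Order.TTheory GRing.Theory Num.Theory.
Import numFieldNormedType.Exports.

(* The hypergraph is uniform among all r-uniform ones. With constant
   probability a constant fraction of the potential objects (simplices, induced
   triangles) are present, so some vertex outputs at least a 1/n fraction of
   them. By Kruskal-Katona, n^r simplices span at least c n^(r-1+1/(r+1)) edges;
   n^(3r-4) triangles span at least c n^(r-2/3) edges, because a pair of vertices
   lies in at most n^(r-2) edges. A correct output thus reveals m such edges,
   although it is a function of the at most n^(r-1) initially known bits and of
   the (B+1) n T bits received in T rounds. A union bound over the vertices gives
   m <= O(n^(r-1)) + (B+1) n T, where the first term is negligible. Silence is
   counted as one more message, so the argument does not depend on which links
   exist and covers both models. *)

(** * Extremal bounds: few edges span few simplices and few triangles *)

Section Combinatorics.
Set Implicit Arguments.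
Unset Strict Implicit.
Unset Printing Implicit Defensive.
Local Open Scope nat_scope.

(** Over the reals one would sum [a i <= c^(1/k) * b i]. To avoid roots, both powers are expanded
    over functions from ['I_k] to [I] and compared term by term, after raising each product to the
    power [k]. *)
Lemma expn_sum_le (I : finType) (k c : nat) (a b : I -> nat) : 0 < k ->
  (forall i, a i ^ k <= c * b i ^ k) ->
  (\sum_i a i) ^ k <= c * (\sum_i b i) ^ k.
Proof.
move=> k_gt0 le_ab.
have expand (g : I -> nat) :
    (\sum_i g i) ^ k = \sum_(f : {ffun 'I_k -> I}) \prod_j g (f j).
  by rewrite -(bigA_distr_bigA (fun=> g)) prod_nat_const card_ord.
rewrite !expand big_distrr /=; apply: leq_sum => f _.
rewrite -(leq_exp2r _ _ k_gt0) expnMn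
  !(big_morph (expn^~ k) (fun x y => expnMn x y k) (exp1n k)).
have -> : c ^ k = \prod_(j < k) c by rewrite prod_nat_const card_ord.
by rewrite -big_split; apply: leq_prod => j _; apply: le_ab.
Qed.

Lemma ffact_le_expn (n k : nat) : n ^_ k <= n ^ k.
Proof.
elim: k n => [|k IH] n //; rewrite ffactnS expnS leq_mul2l.
case: n => [|n] //=; apply: leq_trans (IH n) _.
by case: k {IH} => // k; rewrite leq_exp2r.
Qed.

Lemma bin_le_expn (n k : nat) : 'C(n, k) <= n ^ k.
Proof.
by apply: leq_trans (ffact_le_expn n k); rewrite -bin_ffact leq_pmulr ?fact_gt0.
Qed.

Lemma expn_le_ffact (n k : nat) : (n.+1 - k) ^ k <= n ^_ k.
Proof.
elim: k => // k IH; rewrite subSS expnSr ffactnSr leq_mul2r; apply/orP; right.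
apply: leq_trans IH; case: k => // k; rewrite leq_exp2r //; lia.
Qed.

Lemma expn_le_bin (n k : nat) : (n.+1 - k) ^ k <= k`! * 'C(n, k).
Proof. by rewrite mulnC bin_ffact expn_le_ffact. Qed.

(** Removing [A] is injective on its supersets. Used with one vertex for degrees and with two for
    codegrees. *)
Lemma card_supersets_le (T : finType) (A : {set T}) (k : nat) :
  #|[set e : {set T} | (#|e| == k) && (A \subset e)]%SET| <= #|T| ^ (k - #|A|).
Proof.
apply: leq_trans (bin_le_expn _ _); rewrite -card_draws.
have inj : {in [set e : {set T} | (#|e| == k) && (A \subset e)]%SET &,
    injective (fun e : {set T} => e :\: A)%SET}.
  move=> e e'; rewrite !inE => /andP[_ Ae] /andP[_ Ae'] E.
  by rewrite -(setID e A) -(setID e' A) E (setIidPr Ae) (setIidPr Ae').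
rewrite -(card_in_imset inj); apply: subset_leq_card; apply/subsetP => X.
case/imsetP => e; rewrite !inE => /andP[/eqP ek Ae] ->.
by rewrite cardsD (setIidPr Ae) ek.
Qed.

Lemma sum_degree (T : finType) (P : {set {set T}}) :
  \sum_(x : T) #|[set e in P | x \in e]%SET| = \sum_(e in P) #|e|.
Proof.
under eq_bigr do rewrite -sum1dep_card big_mkcondr.
rewrite exchange_big /=; apply: eq_bigr => e _.
by rewrite -big_mkcond sum1_card.
Qed.

(** The link of [x], as in simplicial complexes. It lowers the uniformity by one, which drives the
    induction in [card_shadow_ge]. *)
Definition vlink (T : finType) (P : {set {set T}}) (x : T) : {set {set T}} :=
  [set e : {set T} | (x \notin e) && (x |: e \in P)]%SET.

Lemma card_vlink (T : finType) (P : {set {set T}}) (x : T) :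
  #|vlink P x| = #|[set e in P | x \in e]%SET|.
Proof.
have inj : {in vlink P x &, injective (fun e : {set T} => x |: e)%SET}.
  move=> e e'; rewrite !inE => /andP[xe _] /andP[xe' _] E.
  by rewrite -(setU1K xe) -(setU1K xe') E.
rewrite -(card_in_imset inj); apply: eq_card => e; apply/imsetP/idP.
  by case=> e'; rewrite inE => /andP[_ eP] ->; rewrite inE eP setU11.
rewrite !inE => /andP[eP xe]; exists (e :\ x)%SET; last by rewrite setD1K.
by rewrite !inE eqxx setD1K.
Qed.

(* A weak form of the Kruskal-Katona theorem. *)
Lemma card_shadow_ge (T : finType) (k : nat) (P S : {set {set T}}) : 0 < k ->
  (forall e, e \in P -> #|e| = k) ->
  (forall s, s \in S ->
     #|s| = k.+1 /\ forall e : {set T}, e \subset s -> #|e| = k -> e \in P) ->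
  #|S| ^ k <= #|P| ^ k.+1.
Proof.
elim: k P S => // -[_ P S _ Pk Sk|k IH P S _ Pk Sk].
  (* Base case: [P] consists of singletons and [S] of pairs inside their union. *)
  rewrite expn1; pose C := \bigcup_(e in P) e.
  have CP : #|C| <= #|P|.
    apply: leq_trans (leq_card_cover P) _.
    by rewrite -sum1_card; apply: leq_sum => e /Pk ->.
  apply: leq_trans (_ : #|[set A : {set T} | A \subset C & #|A| == 2]| <= _).
    apply: subset_leq_card; apply/subsetP => s /Sk[s2 sP]; rewrite inE s2 eqxx.
    rewrite andbT; apply/subsetP => x xs; apply/bigcupP; exists [set x]%SET.
      by apply: sP; rewrite ?cards1 ?sub1set.
    by rewrite inE.
  rewrite cards_draws; apply: leq_trans (bin_le_expn _ _).
  exact: leq_bin2l.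
have Plink x e : e \in vlink P x -> #|e| = k.+1.
  rewrite inE => /andP[xe /Pk]; rewrite cardsU1 xe; lia.
have Slink x s : s \in vlink S x ->
    #|s| = k.+2 /\ forall e : {set T}, e \subset s -> #|e| = k.+1 -> e \in vlink P x.
  rewrite inE => /andP[xs /Sk[]]; rewrite cardsU1 xs => sz sP; split; first lia.
  move=> e es ek; have xe : x \notin e by apply: contra xs; apply: (subsetP es).
  by rewrite inE xe sP ?setUS // cardsU1 xe ek.
(* One factor is at most [#|P|], because removing [x] from a member of [S] leaves a face in [P]; the
   other [k.+1] factors are bounded by induction in the link. *)
have le_link x : #|vlink S x| ^ k.+2 <= #|P| * #|vlink P x| ^ k.+2.
  rewrite expnS leq_mul //; last exact: IH (ltn0Sn _) (Plink x) (Slink x).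
  apply: subset_leq_card; apply/subsetP => s; rewrite inE => /andP[xs /Sk[]].
  rewrite cardsU1 xs => sz; apply; first exact: subsetU1.
  lia.
have := expn_sum_le (ltn0Sn _) le_link.
under eq_bigr do rewrite card_vlink; rewrite sum_degree.
under [in X in _ <= X]eq_bigr do rewrite card_vlink; rewrite sum_degree.
rewrite (eq_bigr _ (fun s sS => (Sk s sS).1)) (eq_bigr _ Pk) !sum_nat_const.
rewrite !expnMn => le1.
(* The degree sums give a factor [k.+3] for [S] and [k.+2] for [P]; weakening the latter to [k.+3]
   lets both cancel. *)
have : #|S| ^ k.+2 * k.+3 ^ k.+2 <= #|P| ^ k.+3 * k.+3 ^ k.+2.
  apply: leq_trans le1 _; rewrite mulnA -expnS leq_mul2l leq_exp2r //.
  by rewrite leqnSn orbT.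
by rewrite leq_pmul2r // expn_gt0.
Qed.

Lemma ord3P (Q : 'I_3 -> Prop) : Q 0%R -> Q 1%R -> Q 2%R -> forall i, Q i.
Proof.
move=> Q0 Q1 Q2 [[|[|[|//]]] lt_i3].
- by rewrite (_ : Ordinal lt_i3 = 0%R) //; apply: val_inj.
- by rewrite (_ : Ordinal lt_i3 = 1%R) //; apply: val_inj.
- by rewrite (_ : Ordinal lt_i3 = 2%R) //; apply: val_inj.
Qed.

(** Let [w x y] count the edges of [P] through both [x] and [y]. It is at most [D] pointwise and [Q]
    in total, and the triangles number at most the sum of [w x y * w y z * w z x], which is at most
    [(D * Q)^(3/2)]. *)
Lemma card_triangles_le (T : finType) (k : nat) (P : {set {set T}})
    (S : {set cycle3 T}) :
  (forall e, e \in P -> #|e| = k) ->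
  (forall t, t \in S -> injective t.1 /\
     forall i : 'I_3, (t.2 i \in P) && (t.1 i \in t.2 (i - 1)%R :&: t.2 i)%SET) ->
  #|S| ^ 2 <= (#|T| ^ (k - 2)) ^ 3 * (k ^ 2 * #|P|) ^ 3.
Proof.
move=> Pk St; set D := #|T| ^ (k - 2); set Q := k ^ 2 * #|P|.
pose w x y := #|[set e in P | [&& x != y, x \in e & y \in e]]%SET|.
have wD x y : w x y <= D.
  have [xy|xy] := eqVneq x y.
    rewrite /w eq_card0 // => e; rewrite !inE xy eqxx andbF //.
  have -> : D = #|T| ^ (k - #|[set x; y]%SET|) by rewrite cards2 xy.
  apply: leq_trans (card_supersets_le _ _); apply: subset_leq_card.
  apply/subsetP => e; rewrite !inE => /andP[/Pk-> /and3P[_ xe ye]].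
  by rewrite eqxx /= subUset !sub1set xe.
have wQ : \sum_x \sum_y w x y <= Q.
  rewrite /w; under eq_bigr do under eq_bigr do rewrite -sum1dep_card big_mkcondr.
  under eq_bigr do rewrite exchange_big /=.
  rewrite exchange_big /= /Q mulnC -sum_nat_const; apply: leq_sum => e /Pk ek.
  rewrite pair_big /= -ek -mulnn -(cardsX e e) -sum1_card big_mkcond /=.
  rewrite [leqRHS]big_mkcond /=; apply: leq_sum => -[x y] _ /=.
  by rewrite inE /=; case: (x \in e); case: (y \in e); case: (x != y).
(* [tr x] is at most the geometric mean of [D ^ 2 * Q] and [D * d_x ^ 2], where
   [d_x] is the weighted degree of [x]. *)
pose tr x := \sum_y \sum_z w x y * w y z * w z x.
have trQ x : tr x ^ 2 <= D ^ 3 * Q * (\sum_y w x y) ^ 2.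
  have w_sym y z : w y z = w z y.
    by apply: eq_card => e; rewrite !inE eq_sym [(y \in e) && _]andbC.
  have tr1 : tr x <= D * D * Q.
    apply: leq_trans (_ : \sum_y \sum_z D * D * w y z <= _).
      apply: leq_sum => y _; apply: leq_sum => z _.
      by rewrite mulnAC leq_mul2r leq_mul ?wD ?orbT.
    by under eq_bigr do rewrite -big_distrr; rewrite -big_distrr leq_mul2l wQ orbT.
  have tr2 : tr x <= D * (\sum_y w x y) ^ 2.
    rewrite -mulnn big_distrlr /= big_distrr; apply: leq_sum => y _.
    rewrite big_distrr; apply: leq_sum => z _.
    by rewrite (w_sym z x) -mulnA mulnCA leq_mul ?wD.
  rewrite -mulnn; apply: leq_trans (leq_mul tr1 tr2) _.
  by rewrite mulnAC -!mulnA leq_eqVlt; apply/orP; left; apply/eqP; rewrite !expnS; lia.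
have := expn_sum_le (isT : 0 < 2) trQ.
have le_tr : #|S| <= \sum_x tr x.
  have -> : \sum_x tr x =
      \sum_(u : T * T * T) w u.1.1 u.1.2 * w u.1.2 u.2 * w u.2 u.1.1.
    rewrite /tr; under eq_bigr do rewrite pair_big /=.
    rewrite pair_big /=.
    rewrite (reindex (fun u : T * T * T => (u.1.1, (u.1.2, u.2)))) //=.
    by exists (fun u => (u.1, u.2.1, u.2.2)) => [[[? ?] ?]|[? [? ?]]].
  (* Group the triangles by their vertices. Edge [i] joins vertices [i] and [i + 1], so the three
     edges lie in a product of three sets counted by [w]. *)
  rewrite -sum1_card (partition_big
    (fun t : cycle3 T => (t.1 0%R, t.1 1%R, t.1 2%R)) xpredT) //=.
  apply: leq_sum => -[[x y] z] _ /=; rewrite sum1dep_card /w -!cardsX.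
  set X := (X in _ <= #|pred_of_set X|).
  pose h (t : cycle3 T) := (t.2 0%R, t.2 1%R, t.2 2%R).
  have inj : {in [set t in S |
      (t.1 0%R, t.1 1%R, t.1 2%R) == (x, y, z)]%SET &, injective h}.
    move=> [v e] [v' e']; rewrite !inE /h /= => /andP[_ /eqP E] /andP[_ /eqP].
    rewrite -E => -[v0 v1 v2] [e0 e1 e2].
    by congr pair; apply/ffunP; apply: ord3P.
  rewrite -(card_in_imset inj); apply: subset_leq_card.
  apply/subsetP => _ /imsetP[t + ->].
  rewrite inE => /andP[tS /eqP[vx vy vz]].
  have [tinj tP] := St t tS.
  have := tP 0%R; have := tP 1%R; have := tP 2%R.
  have -> : (0 - 1 = 2 :> 'I_3)%R by apply: val_inj.
  have -> : (1 - 1 = 0 :> 'I_3)%R by apply: val_inj.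
  have -> : (2 - 1 = 1 :> 'I_3)%R by apply: val_inj.
  rewrite /X !inE /= -vx -vy -vz !(inj_eq tinj).
  by move=> /and3P[-> -> ->] /and3P[-> -> ->] /and3P[-> -> ->].
move=> le2; apply: leq_trans (_ : D ^ 3 * Q * Q ^ 2 <= _); last first.
  by rewrite -mulnA -expnS.
apply: leq_trans (_ : (\sum_x tr x) ^ 2 <= _); first by rewrite leq_exp2r.
by apply: leq_trans le2 _; rewrite leq_mul2l leq_exp2r // wQ orbT.
Qed.

End Combinatorics.

(** * Counting the hypergraphs compatible with what a vertex knows *)

Section Counting.
Set Implicit Arguments.
Unset Strict Implicit.
Unset Printing Implicit Defensive.
Local Open Scope nat_scope.

Definition ksets (V : finType) (r : nat) : {set {set V}} :=
  [set e : {set V} | #|e| == r]%SET.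

Definition uniforms (V : finType) (r : nat) : {set hypergraph V} :=
  [set H | uniform r H]%SET.

Lemma uniformE (V : finType) (r : nat) (H : hypergraph V) :
  uniform r H = (edges H \subset ksets V r).
Proof.
apply/forall_inP/subsetP => [Hr e /Hr|Hr e /Hr]; first by rewrite inE.
by rewrite inE.
Qed.

(** Such an [H] is determined by an arbitrary set of [r]-sets outside [P]; as [r] is positive, no
    empty edge arises. *)
Lemma card_uniforms_above (V : finType) (r : nat) (P : {set {set V}}) :
  0 < r -> P \subset ksets V r ->
  #|[set H in uniforms V r | P \subset edges H]%SET| = 2 ^ (#|ksets V r| - #|P|).
Proof.
move=> r_gt0 PU; set U := ksets V r.
have -> : #|U| - #|P| = #|U :\: P|%SET by rewrite cardsD (setIidPr PU).
rewrite -card_powerset.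
have injU : {in powerset (U :\: P)%SET &,
    injective (fun X : {set {set V}} => P :|: X)%SET}.
  move=> X Y; rewrite !powersetE !subsetD => /andP[_ PX] /andP[_ PY] E.
  have eqD (Z : {set {set V}}) :
      [disjoint Z & P] -> (P :|: Z) :\: P = Z :> {set {set V}}.
    by move=> ZP; rewrite finset.setDUl finset.setDv finset.set0U; apply/setDidPl.
  by rewrite -(eqD X) // -(eqD Y) // E.
rewrite -(card_in_imset injU) -(card_imset _ (@val_inj _ _ (hypergraph V))).
apply: eq_card => E; apply/imsetP/imsetP => [[H + ->]|[X + ->]].
  rewrite !inE uniformE => /andP[HU PH]; exists (edges H :\: P)%SET.
    by rewrite powersetE setSD.
  by rewrite -[LHS](finset.setID (edges H) P) (setIidPr PH).
rewrite powersetE subsetD => /andP[XU _].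
have PXU : (P :|: X \subset U)%SET by rewrite subUset PU.
have ne : set0 \notin (P :|: X)%SET.
  by apply/negP => /(subsetP PXU); rewrite inE cards0 eq_sym -leqn0 leqNgt r_gt0.
by exists (Hypergraph ne); rewrite // !inE uniformE /= PXU subsetUl.
Qed.

Lemma card_uniforms (V : finType) (r : nat) : 0 < r ->
  #|uniforms V r| = 2 ^ #|ksets V r|.
Proof.
move=> r_gt0; have := card_uniforms_above r_gt0 (sub0set (ksets V r)).
rewrite cards0 subn0 => <-; apply: eq_card => H.
by rewrite [in RHS]inE sub0set andbT.
Qed.

(** Knowing [m] edges costs a factor [2 ^ m]. If [P] has a member of the wrong size, no [H]
    qualifies. *)
Lemma card_uniforms_above_le (V : finType) (r m : nat) (P : {set {set V}}) :
  0 < r -> m <= #|P| ->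
  2 ^ m * #|[set H in uniforms V r | P \subset edges H]%SET| <= 2 ^ #|ksets V r|.
Proof.
move=> r_gt0 mP; case: (boolP (P \subset ksets V r)) => PU; last first.
  rewrite (_ : [set H in _ | _] = set0)%SET ?cards0 ?muln0 //.
  apply/setP => H; rewrite !inE uniformE; apply/negP => /andP[HU PH].
  by rewrite (fintype.subset_trans PH HU) in PU.
rewrite card_uniforms_above // -expnD leq_pexp2l //.
have := subset_leq_card PU; lia.
Qed.

Lemma card_bigcup_le (I T : finType) (A : I -> {set T}) :
  #|\bigcup_i A i| <= \sum_i #|A i|.
Proof.
elim/big_rec2: _ => [|i n X _ le_X]; first by rewrite cards0.
by rewrite (leq_trans (leq_card_setU _ _)) // leq_add2l.
Qed.

(** An abstract enumeration problem: [o] needs the edges [req o], and [F] is a family of potential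
    objects, each needing at most [k] edges. Outputs may also lie outside [F]. By [many_req], a
    large correct output reveals [m] edges. *)
Variables (V O : finType) (r : nat) (target : hypergraph V -> {set O}).
Variables (F : {set O}) (req : O -> {set {set V}}) (k m : nat).
Hypothesis r_gt0 : 0 < r.
Hypothesis F_neq0 : 0 < #|F|.
Hypothesis card_req : forall o, o \in F -> #|req o| <= k.
Hypothesis uniform_req : forall o, o \in F -> req o \subset ksets V r.
Hypothesis req_target : forall (H : hypergraph V) o, uniform r H ->
  o \in F -> req o \subset edges H -> o \in target H.
Hypothesis target_req : forall (H : hypergraph V) o, uniform r H ->
  o \in target H -> req o \subset edges H.
Hypothesis many_req : forall (H : hypergraph V) (S : {set O}), uniform r H ->
  S \subset target H -> #|F| <= #|V| * (2 ^ k.+1 * #|S|) ->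
  m <= #|\bigcup_(o in S) req o|.

Let N := #|ksets V r|.

(** The threshold [#|F| / 2 ^ k.+1] is half the lower bound on the expected number of surviving
    objects of [F]. *)
Definition rich : {set hypergraph V} :=
  [set H in uniforms V r | #|F| <= 2 ^ k.+1 * #|target H|]%SET.

(* Reverse Markov inequality: an object of [F] survives with probability at
   least [2 ^- k], and at most [#|F|] objects do. *)
Lemma card_rich : 2 ^ N <= 2 ^ k.+1 * #|rich|.
Proof.
pose X (H : hypergraph V) := #|[set o in F | req o \subset edges H]%SET|.
have XF H : X H <= #|F|.
  by apply: subset_leq_card; apply/subsetP => o; rewrite inE => /andP[].
(* Double counting of the pairs of an object and a hypergraph containing its edges. *)
have lower : #|F| * 2 ^ N <= 2 ^ k * \sum_(H in uniforms V r) X H.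
  rewrite /X; under eq_bigr do rewrite -sum1dep_card big_mkcondr.
  rewrite exchange_big /= -sum_nat_const big_distrr; apply: leq_sum => o oF.
  rewrite -big_mkcondr sum1dep_card /=.
  have -> : #|[set H | (H \in uniforms V r) && (req o \subset edges H)]%SET| =
     #|[set H in uniforms V r | req o \subset edges H]%SET| by [].
  rewrite card_uniforms_above ?uniform_req // -expnD leq_pexp2l //.
  by have := card_req oF; have := subset_leq_card (uniform_req oF); rewrite /N; lia.
(* A rich hypergraph contains at most [#|F|] of the objects, any other one less than
   [#|F| / 2 ^ k.+1]. *)
have upper : 2 ^ k.+1 * \sum_(H in uniforms V r) X H <=
    #|rich| * (2 ^ k.+1 * #|F|) + 2 ^ N * #|F|.
  rewrite (bigID (mem rich)) /= mulnDr leq_add //.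
    rewrite big_distrr /=; apply: leq_trans (_ : \sum_(H in rich) 2 ^ k.+1 * #|F| <= _).
      rewrite big_mkcond [leqRHS]big_mkcond; apply: leq_sum => H _.
      case: ifP => [/andP[_ ->]|_]; last exact: leq0n.
      by rewrite leq_mul2l XF orbT.
    by rewrite sum_nat_const.
  rewrite big_distrr /= /N -card_uniforms // -sum_nat_const.
  rewrite big_mkcond [leqRHS]big_mkcond; apply: leq_sum => H _.
  case: ifP => [/andP[Hr]|_]; last exact: leq0n.
  rewrite Hr inE Hr -ltnNge => /ltnW; apply: leq_trans.
  rewrite leq_mul2l; apply/orP; right; apply: subset_leq_card.
  rewrite inE in Hr; apply/subsetP => o; rewrite inE => /andP[oF oH].
  exact: req_target oH.
have : 2 * (#|F| * 2 ^ N) <= #|rich| * (2 ^ k.+1 * #|F|) + 2 ^ N * #|F|.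
  by apply: leq_trans upper; rewrite expnS -mulnA leq_mul2l.
rewrite [2 ^ N * _]mulnC mul2n -addnn leq_add2r mulnCA [#|F| * _]mulnC mulnA.
by rewrite leq_pmul2r // mulnC.
Qed.

Variables (R : realType) (B : nat) (M : model) (A : algorithm R V B O).
Variable w : {ffun V -> coins A}.

(** Only the output of [v] is constrained, not the whole run, so that the view of [v] alone decides
    which edges are revealed. *)
Definition informed (v : V) : {set hypergraph V} :=
  [set H in uniforms V r | (outcome M H w v \subset target H) &&
     (#|F| <= #|V| * (2 ^ k.+1 * #|outcome M H w v|))]%SET.

Lemma size_received (H : hypergraph V) (t : nat) (v : V) :
  size (received M H w t v) = t.
Proof. by elim: t => //= t IH; rewrite size_rcons IH. Qed.

(* The output of a vertex is a function of its incident edges and of what it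
   received, and it reveals at least [m] edges of the hypergraph. *)
Lemma card_informed (v : V) :
  2 ^ m * #|informed v| <=
  2 ^ (#|V| ^ r.-1) * (2 ^ B.+1) ^ (#|V| * rounds A) * 2 ^ N.
Proof.
pose T := (rounds A).-tuple {ffun V -> option (B.-tuple bool)}.
pose view (H : hypergraph V) : {set {set V}} * T :=
  (incident H v, Tuple (introT eqP (size_received H (rounds A) v))).
pose Iv := [set e : {set V} | (#|e| == r) && ([set v]%SET \subset e)]%SET.
pose views := setX (powerset Iv) [set: T]%SET.
have view_in H : H \in informed v -> view H \in views.
  rewrite !inE andbT => /andP[Hr _].
  apply/subsetP => e; rewrite !inE sub1set => /andP[eH ->].
  by rewrite andbT; have /forall_inP := Hr; apply.
apply: leq_trans (_ : \sum_(x in views) 2 ^ N <= _); last first.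
  rewrite sum_nat_const leq_mul2r cardsX card_powerset cardsT card_tuple.
  rewrite card_ffun card_option card_tuple card_bool -expnM; apply/orP; right.
  rewrite leq_mul //.
    by rewrite leq_pexp2l // (leq_trans (card_supersets_le _ _)) // cards1 subn1.
  (* Silence adds one value to the [2 ^ B] messages, and [2 ^ B + 1 <= 2 ^ B.+1]. *)
  rewrite !expnM; case: (rounds A) => // t; rewrite leq_exp2r //.
  case: #|V| => // c; rewrite leq_exp2r // expnS mul2n -addnn -addn1 leq_add2l.
  by rewrite expn_gt0.
have -> : #|informed v| = \sum_(x in views) #|[set H in informed v | view H == x]%SET|.
  rewrite -sum1_card (partition_big view (mem views)) //.
  by apply: eq_bigr => x _; rewrite sum1dep_card.
rewrite big_distrr; apply: leq_sum => -[I t] _ /=.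
set S := output v I (w v) t.
have out H : H \in [set H in informed v | view H == (I, t)]%SET -> outcome M H w v = S.
  rewrite inE => /andP[_ /eqP[EI Et]]; rewrite /outcome /S -EI -Et //.
(* All hypergraphs with this view produce the same output [S]. If one exists, [S] requires at least
   [m] edges, and every one of them contains these edges. *)
case: (set_0Vmem [set H in informed v | view H == (I, t)]%SET) => [->|[H0 H0in]].
  by rewrite cards0 muln0.
have mS : m <= #|\bigcup_(o in S) req o|%SET.
  have := H0in; rewrite 2!inE -(out _ H0in) => /andP[/andP[Hr /andP[St SF]] _].
  by rewrite inE in Hr; apply: many_req St SF.
apply: leq_trans (card_uniforms_above_le r_gt0 mS).
rewrite leq_mul2l; apply/orP; right; apply: subset_leq_card.
apply/subsetP => H Hin; have oE := out _ Hin.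
have [Hr /subsetP St] : H \in uniforms V r /\ S \subset target H.
  by move: Hin; rewrite 2!inE oE => /andP[/and3P[Hr St _] _].
rewrite inE Hr /=.
by apply/bigcupsP => o /St; apply: target_req; rewrite inE in Hr.
Qed.

(** Success on all but a [2 ^- k.+2] fraction leaves many hypergraphs that are both rich and
    correctly solved. In each of these some vertex is informed, so a union bound over the vertices
    applies. *)
Lemma rounds_count :
  (2 ^ k.+2).-1 * 2 ^ N <=
    2 ^ k.+2 * #|[set H in uniforms V r | enumerates M H w (target H)]%SET| ->
  2 ^ m <= 2 ^ k.+2 * (#|V| * (2 ^ (#|V| ^ r.-1) * (2 ^ B.+1) ^ (#|V| * rounds A))).
Proof.
set G := [set H in _ | enumerates _ _ _ _]%SET => Gbig.
(* Inclusion-exclusion: a fraction of at least [2 ^- k.+1] is rich, and at most half of that amount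
   fails. *)
have cap : 2 ^ N <= 2 ^ k.+2 * #|(rich :&: G)%SET|.
  have le1 : #|rich| + #|G| <= #|(rich :&: G)%SET| + 2 ^ N.
    rewrite -cardsUI addnC leq_add2l /N -card_uniforms //; apply: subset_leq_card.
    by apply/subsetP => H; rewrite !inE => /orP[] /andP[].
  have := card_rich; have : 0 < 2 ^ k.+2 by rewrite expn_gt0.
  move: Gbig le1; rewrite [2 ^ k.+2]expnS; nia.
have sub : (rich :&: G \subset \bigcup_(v : V) informed v)%SET.
  apply/subsetP => H; rewrite inE => /andP[Hrich HG].
  move: Hrich HG; rewrite ![H \in _]inE.
  case/andP=> Hr Ht /andP[_] /andP[_ /eqP E].
  have tle : #|target H| <= \sum_v #|outcome M H w v|.
    by rewrite -E; apply: card_bigcup_le.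
  (* Pigeonhole: if every output were too small, the union could not reach the rich threshold. *)
  suff [v vbig] : exists v, #|F| <= #|V| * (2 ^ k.+1 * #|outcome M H w v|).
    apply/bigcupP; exists v => //; rewrite !inE Hr vbig andbT /= -E.
    exact: bigcup_sup.
  apply/existsP; apply: contraT; rewrite negb_exists => /forallP small.
  (* Without vertices the union of the outputs is empty, contradicting richness. *)
  have [v0|V0] := pickP (@predT V); last first.
    move: tle; rewrite big_pred0 // leqn0 => /eqP t0.
    by move: Ht; rewrite t0 muln0 leqNgt F_neq0.
  have V_gt0 : 0 < #|V| by apply/card_gt0P; exists v0.
  have : \sum_(v : V) (#|V| * (2 ^ k.+1 * #|outcome M H w v|)).+1 <= \sum_(v : V) #|F|.
    by apply: leq_sum => v _; rewrite ltnNge small.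
  under eq_bigr do rewrite -addn1.
  rewrite big_split /= !sum_nat_const -!big_distrr /= -mulnDr leq_pmul2l //.
  have : 2 ^ k.+1 * #|target H| <= 2 ^ k.+1 * \sum_v #|outcome M H w v|.
    by rewrite leq_mul2l tle orbT.
  by move=> le2 le1; move: (leq_trans Ht le2); rewrite leqNgt -addn1 le1.
have : 2 ^ m * 2 ^ N <=
    2 ^ k.+2 * (#|V| * (2 ^ (#|V| ^ r.-1) * (2 ^ B.+1) ^ (#|V| * rounds A))) * 2 ^ N.
  apply: leq_trans (_ : 2 ^ m * (2 ^ k.+2 * #|(rich :&: G)%SET|) <= _).
    by rewrite leq_mul2l cap orbT.
  rewrite mulnCA -mulnA leq_mul2l; apply/orP; right.
  apply: leq_trans (_ : 2 ^ m * \sum_(v : V) #|informed v| <= _).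
    rewrite leq_mul2l; apply/orP; right.
    exact: leq_trans (subset_leq_card sub) (card_bigcup_le _).
  rewrite big_distrr -mulnA -sum_nat_const; apply: leq_sum => v _.
  exact: card_informed.
by rewrite leq_pmul2r ?expn_gt0.
Qed.

End Counting.

(** * The uniform distribution and the removal of randomness *)

Section Randomness.
Set Implicit Arguments.
Unset Strict Implicit.
Unset Printing Implicit Defensive.
Local Open Scope ring_scope.

Section UniformDist.
Variables (R : realType) (V : finType) (r : nat).
Hypothesis r_gt0 : (0 < r)%N.

Let mass (H : hypergraph V) : R :=
  if uniform r H then (2 ^ #|ksets V r|)%:R^-1 else 0.

Lemma mass_ge0 H : 0 <= mass H.
Proof. by rewrite /mass; case: ifP => // _; rewrite invr_ge0 ler0n. Qed.

Lemma sum_mass (Q : pred (hypergraph V)) :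
  \sum_(H | Q H) mass H =
  #|[set H in uniforms V r | Q H]%SET|%:R / (2 ^ #|ksets V r|)%:R.
Proof.
rewrite -big_mkcondr /= sumr_const [RHS]mulr_natl.
by congr (_ *+ _); apply: eq_card => H; rewrite !inE andbC.
Qed.

Lemma mass_sum1 : \sum_H mass H = 1.
Proof.
rewrite (sum_mass xpredT) (_ : [set H in _ | _]%SET = uniforms V r).
  by rewrite card_uniforms // divff // pnatr_eq0 -lt0n expn_gt0.
by apply/setP => H; rewrite !inE andbT.
Qed.

Definition uniform_dist : fdist R (hypergraph V) := FDist mass_ge0 mass_sum1.

End UniformDist.

Lemma sum_coins (R : realType) (V : finType) (B : nat) (O : finType)
    (A : algorithm R V B O) :
  \sum_(w : {ffun V -> coins A}) \prod_v coins_law A v (w v) = 1.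
Proof.
rewrite -(bigA_distr_bigA (fun v x => coins_law A v x)).
by rewrite big1 // => v _; rewrite Defs.pmf_sum1.
Qed.

(* Averaging over the coins makes the algorithm deterministic. *)
Lemma good_coins (R : realType) (V : finType) (B : nat) (O : finType)
    (M : model) (A : algorithm R V B O) (D : fdist R (hypergraph V))
    (target : hypergraph V -> {set O}) (p : R) :
  p <= success_prob M A D target ->
  exists w : {ffun V -> coins A}, p <= \sum_(H | enumerates M H w (target H)) D H.
Proof.
move=> p_le; pose q (w : {ffun V -> coins A}) := \prod_v coins_law A v (w v).
pose g (w : {ffun V -> coins A}) := \sum_(H | enumerates M H w (target H)) D H.
have q_ge0 w : 0 <= q w by apply: prodr_ge0 => v _; apply: Defs.pmf_ge0.
have E : success_prob M A D target = \sum_w q w * g w.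
  rewrite /success_prob; under eq_bigr do rewrite big_mkcond.
  rewrite exchange_big; apply: eq_bigr => w _ /=.
  rewrite /g mulr_sumr [RHS]big_mkcond; apply: eq_bigr => H _.
  by case: ifP => // _; rewrite mulrC.
(* If every [g w] were below [p], then all [q w] would vanish, although they sum to 1. *)
have [//|none] := pselect (exists w, p <= g w).
have lt_gp w : g w < p by rewrite ltNge; apply/negP => le; apply: none; exists w.
have dif0 : \sum_w q w * (p - g w) = 0.
  apply/eqP; rewrite eq_le sumr_ge0 ?andbT; last first.
    by move=> w _; rewrite mulr_ge0 // subr_ge0 ltW.
  under eq_bigr do rewrite mulrBr.
  by rewrite sumrB -mulr_suml sum_coins mul1r -E subr_le0.
have : \sum_w q w = 0.
  have dif_ge0 w : true -> 0 <= q w * (p - g w).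
    by move=> _; rewrite mulr_ge0 // subr_ge0 ltW.
  apply: big1 => w _; apply/eqP.
  have /eqP : q w * (p - g w) = 0 := psumr_eq0P dif_ge0 dif0 isT.
  by rewrite mulf_eq0 subr_eq0 [p == g w]gt_eqF // orbF.
by rewrite sum_coins => /eqP; rewrite oner_eq0.
Qed.

(** Restates the success probability as an integer count of hypergraphs, the form in which
    [rounds_count] takes it. *)
Lemma success_count (R : realType) (V : finType) (r : nat) (r_gt0 : (0 < r)%N)
    (B : nat) (O : finType) (M : model) (A : algorithm R V B O)
    (target : hypergraph V -> {set O}) (k : nat) :
  1 - (2 ^ k)%:R^-1 <= success_prob M A (uniform_dist R V r_gt0) target ->
  exists w : {ffun V -> coins A}, ((2 ^ k).-1 * 2 ^ #|ksets V r| <=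
    2 ^ k * #|[set H in uniforms V r | enumerates M H w (target H)]%SET|)%N.
Proof.
case/good_coins => w; rewrite sum_mass => le; exists w; move: le.
have pos j : 0 < (2 ^ j)%:R :> R by rewrite ltr0n expn_gt0.
rewrite ler_pdivlMr // -(ler_pM2l (pos k)) mulrA mulrBr mulr1.
rewrite mulfV ?gt_eqF // -(ler_nat R) !natrM; congr (_ * _ <= _).
by rewrite -[in LHS](prednK (n := 2 ^ k)) ?expn_gt0 // -natr1 addrK.
Qed.

End Randomness.

(** * From bit counts to asymptotic round bounds *)

Section Asymptotics.
Set Implicit Arguments.
Unset Strict Implicit.
Unset Printing Implicit Defensive.
Local Open Scope classical_set_scope.
Local Open Scope ring_scope.

(** Taking logarithms bounds [m] by initial knowledge plus communication. Since [a * r.-1 < b], the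
    former is too small for large [n], so communication accounts for at least half of [m]. *)
Lemma bits_count (r k a b c n m B T : nat) : (2 <= r)%N -> (0 < a)%N ->
  (a * r.-1 < b)%N -> (c * (2 * (k + 4)) ^ a < n)%N ->
  (n ^ b <= c * m ^ a)%N ->
  (2 ^ m <= 2 ^ k.+2 * (n * (2 ^ (n ^ r.-1) * (2 ^ B.+1) ^ (n * T))))%N ->
  (n ^ b <= c * 2 ^ a * (n * (B.+1 * T)) ^ a)%N.
Proof.
move=> r_ge2 a_gt0 ab n_big nm bits.
have n_gt0 : (0 < n)%N by lia.
have n_le : (n <= n ^ r.-1)%N by rewrite -{1}[n]expn1 leq_pexp2l //; lia.
have m_le : (m <= k.+2 + (n + (n ^ r.-1 + B.+1 * (n * T))))%N.
  rewrite -(@leq_exp2l 2) //; apply: leq_trans bits _; rewrite -expnM -expnD.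
  rewrite (expnD _ k.+2) (expnD _ n) leq_mul2l leq_mul2r.
  by apply/orP; right; apply/orP; right; apply: ltnW (ltn_expl _ _).
(* [Y] absorbs [k.+2], the [n] coming from the union bound via [n <= 2 ^ n], and [n ^ r.-1]: hence
   [k + 4]. *)
set Y := ((k + 4) * n ^ r.-1)%N; set Z := (n * (B.+1 * T))%N.
have m_YZ : (m <= Y + Z)%N.
  apply: leq_trans m_le _; rewrite /Y /Z mulnCA; nia.
case: (leqP Y Z) => YZ.
  apply: leq_trans nm _; rewrite -mulnA -expnMn leq_mul2l leq_exp2r //.
  by apply/orP; right; lia.
(* The case [Z < Y] is impossible: it would give [n ^ b < n ^ (a * r.-1 + 1)]. *)
have : (n ^ b <= c * (2 * Y) ^ a)%N.
  apply: leq_trans nm _; rewrite leq_mul2l leq_exp2r //.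
  by apply/orP; right; lia.
rewrite /Y mulnA expnMn -expnM mulnA leqNgt.
suff -> : (c * (2 * (k + 4)) ^ a * n ^ (r.-1 * a) < n ^ b)%N by [].
apply: leq_trans (_ : n * n ^ (r.-1 * a) <= _)%N.
  by rewrite ltn_pmul2r ?expn_gt0 ?n_gt0.
by rewrite -expnS leq_pexp2l // mulnC.
Qed.

Lemma powR_root_le (R : realType) (a b c n Z : nat) : (0 < a)%N ->
  (n ^ b <= c * Z ^ a)%N ->
  n%:R `^ (b%:R / a%:R) <= c%:R `^ a%:R^-1 * Z%:R :> R.
Proof.
move=> a_gt0 le.
have a_neq0 : a%:R != 0 :> R by rewrite pnatr_eq0 -lt0n.
rewrite powRrM powR_mulrn ?ler0n //.
have -> : Z%:R = (Z%:R ^+ a) `^ a%:R^-1 :> R.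
  by rewrite -powR_mulrn ?ler0n // -powRrM mulfV // powRr1 ?ler0n.
rewrite -powRM ?ler0n ?exprn_ge0 ?ler0n //; apply: ge0_ler_powR.
- by rewrite invr_ge0 ler0n.
- by rewrite nnegrE exprn_ge0 ?ler0n.
- by rewrite nnegrE mulr_ge0 ?exprn_ge0 ?ler0n.
- by rewrite -!natrX -natrM ler_nat.
Qed.

(** The extra 1 for silence is absorbed into the constant, since [ln n] is at least 1 once [n]
    exceeds [e]. *)
Lemma bandwidth_le (R : realType) (B : nat -> nat) :
  (fun n => (B n)%:R : R^o) \is 'Theta_\oo (fun n => ln n%:R : R^o) ->
  exists2 C : R, 0 < C & \forall n \near \oo, (B n).+1%:R <= C * ln n%:R.
Proof.
move=> /asboolP[[k1 k2] /= /andP[k1_gt0 k2_gt0] nB].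
exists (k2 + 1); first by rewrite addr_gt0.
have ln_ge1 : \forall n \near \oo, (1 <= ln (n%:R : R)).
  near=> n; have n_ge : expR 1 <= n%:R :> R by near: n; apply: nbhs_infty_ger.
  have n_gt0 : 0 < n%:R :> R := lt_le_trans (expR_gt0 1) n_ge.
  by rewrite -[leLHS](expRK (1 : R)) ler_ln ?posrE ?expR_gt0.
near=> n.
have ln1 : 1 <= ln (n%:R : R) by near: n.
have [_] : k1 * `|ln n%:R : R^o| <= `|(B n)%:R : R^o| /\
    `|(B n)%:R : R^o| <= k2 * `|ln n%:R : R^o|.
  by near: n; exact: nB.
rewrite !ger0_norm ?ler0n ?(le_trans ler01) // => le.
by rewrite -natr1 mulrDl mul1r lerD.
Unshelve. all: by end_near. Qed.

(** The condition [n ^ b <= c * m ^ a] says in integers that [m] is at least of order [n^(b/a)]. A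
    vertex receives about [n * (B n).+1] bits per round, whence [alpha = b/a - 1]. *)
Lemma requires_rounds_uniform (R : realType) (r : nat) (r_gt0 : (0 < r)%N)
    (B : nat -> nat) (M : model) (O : nat -> finType)
    (target : forall n, hypergraph 'I_n -> {set O n})
    (F : forall n, {set O n}) (req : forall n, O n -> {set {set 'I_n}})
    (k a b c n0 : nat) (alpha : R) :
  (2 <= r)%N -> (0 < a)%N -> (0 < c)%N -> (a * r.-1 < b)%N ->
  alpha + 1 = b%:R / a%:R ->
  (fun n => (B n)%:R : R^o) \is 'Theta_\oo (fun n => ln n%:R : R^o) ->
  (forall n, (n0 <= n)%N -> (0 < #|F n|)%N) ->
  (forall n o, o \in F n -> (#|req n o| <= k)%N /\ req n o \subset ksets 'I_n r) ->
  (forall n (H : hypergraph 'I_n) o, uniform r H ->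
    o \in F n -> req n o \subset edges H -> o \in target n H) ->
  (forall n (H : hypergraph 'I_n) o, uniform r H ->
    o \in target n H -> req n o \subset edges H) ->
  (forall n (H : hypergraph 'I_n) (S : {set O n}), (n0 <= n)%N -> uniform r H ->
    S \subset target n H -> (#|F n| <= n * (2 ^ k.+1 * #|S|))%N ->
    (n ^ b <= c * #|(\bigcup_(o in S) req n o)%SET| ^ a)%N) ->
  requires_rounds M B (fun n => uniform_dist R 'I_n r_gt0)
    (1 - (2 ^ k.+2)%:R^-1) target (fun n => n%:R `^ alpha / ln n%:R).
Proof.
move=> r_ge2 a_gt0 c_gt0 ab alphaE Btheta F_gt0 reqF req_target target_req many.
have [C3 C3_gt0 nB] := bandwidth_le Btheta.
set C2 : R := (c * 2 ^ a)%:R `^ a%:R^-1.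
have C2_gt0 : 0 < C2 by apply: powR_gt0; rewrite ltr0n muln_gt0 c_gt0 expn_gt0.
exists (C2 * C3)^-1; first by rewrite invr_gt0 mulr_gt0.
near=> n => A success.
have n_ge : (n0 <= n)%N by near: n; apply: nbhs_infty_ge.
have n_gt : (c * (2 * (k + 4)) ^ a < n)%N by near: n; apply: nbhs_infty_gt.
have n_gt0 : (0 < n)%N by lia.
have B_le : (B n).+1%:R <= C3 * ln (n%:R : R) by near: n.
have [w count] := success_count success.
(* The least such [m] turns the hypothesis [many] into a lower bound [m] on the number of revealed
   edges. *)
have exm : exists m, (n ^ b <= c * m ^ a)%N.
  exists (n ^ b)%N; apply: leq_trans (leq_pmull _ c_gt0).
  by rewrite -[X in (X <= _)%N]expn1 leq_pexp2l // expn_gt0 n_gt0.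
have [m nm m_min] := ex_minnP exm.
have bits := rounds_count r_gt0 (F_gt0 n n_ge) (fun o oF => (reqF n o oF).1)
  (fun o oF => (reqF n o oF).2) (@req_target n) (@target_req n) (m := m) _ count.
rewrite card_ord in bits.
have {}bits := bits (fun H S Hr St SF => m_min _ (many n H S n_ge Hr St SF)).
have le := powR_root_le R a_gt0 (bits_count r_ge2 a_gt0 ab n_gt nm bits).
have ln_gt0 : 0 < ln (n%:R : R).
  by rewrite -(pmulr_rgt0 _ C3_gt0); apply: lt_le_trans B_le.
have nR_gt0 : 0 < n%:R :> R by rewrite ltr0n.
(* One factor [n] of [n^(alpha + 1)] cancels against the number of senders. *)
move: le; rewrite -/C2 -alphaE powRD; last by apply/implyP => _; rewrite gt_eqF.
rewrite powRr1 ?ler0n // natrM mulrCA [X in X <= _]mulrC ler_pM2l // natrM => le.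
rewrite mulrA ler_pdivrMr // mulrC ler_pdivrMr ?mulr_gt0 //.
apply: le_trans le _.
rewrite [leRHS](_ : _ = C2 * ((C3 * ln n%:R) * (rounds A)%:R)); last by ring.
by rewrite ler_pM2l // ler_wpM2r ?ler0n.
Unshelve. all: by end_near. Qed.

End Asymptotics.

Local Open Scope classical_set_scope.
Local Open Scope ring_scope.

(** * Simplices and triangles as instances *)

Section Instances.
Set Implicit Arguments.
Unset Strict Implicit.
Unset Printing Implicit Defensive.
Local Open Scope nat_scope.

Definition simplex_facets (V : finType) (r : nat) (S : {set V}) : {set {set V}} :=
  [set e : {set V} | (e \subset S) && (#|e| == r)]%SET.

(** [n <= 2 * (n - r)], and [n - r] is the smallest factor of the falling factorial. *)
Lemma card_ksets_ge (r n : nat) : r.*2 <= n -> 0 < r ->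
  n ^ r.+1 <= 2 ^ r.+1 * (r.+1)`! * #|ksets 'I_n r.+1|.
Proof.
move=> n_ge r_gt0.
have -> : #|ksets 'I_n r.+1| = 'C(n, r.+1) by rewrite -[n in RHS]card_ord -card_draws.
apply: leq_trans (_ : (2 * (n - r)) ^ r.+1 <= _); first by rewrite leq_exp2r //; lia.
rewrite expnMn -mulnA leq_mul2l; apply/orP; right.
by rewrite -[n - r]subSS; apply: expn_le_bin.
Qed.

(** [S] has order at least [n ^ r], so the shadow bound gives exponent
    [r * r / (r + 1) = r - 1 + 1 / (r + 1)]. *)
Lemma simplices_many (r n : nat) (H : hypergraph 'I_n) (S : {set {set 'I_n}}) :
  0 < r -> r.*2 <= n -> uniform r H -> S \subset simplices r H ->
  #|ksets 'I_n r.+1| <= n * (2 ^ r.+2 * #|S|) ->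
  n ^ (r * r) <=
    (2 ^ r.+1 * (r.+1)`! * 2 ^ r.+2) ^ r *
    #|(\bigcup_(s in S) simplex_facets r s)%SET| ^ r.+1.
Proof.
move=> r_gt0 n_ge Hr /subsetP St Sbig; set P := (\bigcup_(_ in _) _)%SET.
have n_gt0 : 0 < n by clear -r_gt0 n_ge; lia.
have nS : n ^ r <= 2 ^ r.+1 * (r.+1)`! * 2 ^ r.+2 * #|S|.
  rewrite -(leq_pmul2l n_gt0) -expnS; apply: leq_trans (card_ksets_ge n_ge r_gt0) _.
  by rewrite -(mulnA (2 ^ r.+1 * (r.+1)`!)) [leqRHS]mulnCA leq_mul2l Sbig orbT.
rewrite expnM; apply: leq_trans (_ : (2 ^ r.+1 * (r.+1)`! * 2 ^ r.+2 * #|S|) ^ r <= _).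
  by rewrite leq_exp2r.
rewrite expnMn leq_mul2l; apply/orP; right; apply: card_shadow_ge => // [e|s sS].
  by case/bigcupP => s _; rewrite inE => /andP[_ /eqP].
have := St s sS; rewrite inE => /andP[/eqP s_card _]; split=> // e es er.
by apply/bigcupP; exists s; rewrite // inE es er eqxx.
Qed.

Definition triangle_edges (V : finType) (t : cycle3 V) : {set {set V}} :=
  [set t.2 i | i : 'I_3]%SET.

(** The conditions are reindexed so that each concerns a single edge; once the vertices are fixed,
    the edges can be chosen independently. Distinctness of the edges follows. *)
Definition induced_shape (V : finType) (r : nat) : {set cycle3 V} :=
  [set t : cycle3 V | injectiveb t.1 && [forall i : 'I_3, [&& #|t.2 i| == r,
     t.1 i \in t.2 i, t.1 (i + 1)%R \in t.2 i & t.1 (i - 1)%R \notin t.2 i]]]%SET.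

Lemma induced_shapeP (V : finType) (r : nat) (H : hypergraph V) (t : cycle3 V) :
  t \in induced_shape V r -> triangle_edges t \subset edges H ->
  t \in induced_triangles H.
Proof.
rewrite !inE => /andP[tinj /forallP tP] /subsetP tH.
have tE i : t.2 i \in edges H by apply: tH; apply: imset_f.
have next_in i : t.1 (i + 1)%R \in t.2 i by have /and4P[] := tP i.
have prev_notin i : t.1 i \notin t.2 (i + 1)%R.
  by have /and4P[_ _ _] := tP (i + 1)%R; rewrite addrK.
have next_neq i : t.2 i <> t.2 (i + 1)%R.
  by move=> E; have := prev_notin i; rewrite -E; have /and4P[_ -> _ _] := tP i.
have e_inj : injectiveb t.2.
  (* Modulo 3, any two distinct indices are consecutive. *)
  apply/injectiveP; apply: ord3P; apply: ord3P => //; move=> E; exfalso.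
  - by apply: (next_neq 0%R); rewrite E; congr (t.2 _); apply: val_inj.
  - by apply: (next_neq 2%R); rewrite -E; congr (t.2 _); apply: val_inj.
  - by apply: (next_neq 0%R); rewrite -E; congr (t.2 _); apply: val_inj.
  - by apply: (next_neq 1%R); rewrite E; congr (t.2 _); apply: val_inj.
  - by apply: (next_neq 2%R); rewrite E; congr (t.2 _); apply: val_inj.
  - by apply: (next_neq 1%R); rewrite -E; congr (t.2 _); apply: val_inj.
rewrite /is_induced_triangle /is_triangle tinj e_inj /= -!andbA.
apply/and3P; split; first exact/forallP.
- apply/forallP => i; rewrite inE; have /and4P[_ -> _ _] := tP i.
  by rewrite andbT -[X in t.1 X](subrK 1%R i) next_in.
- exact/forallP.
Qed.

(** Choose three distinct vertices, then complete each edge by [r - 2] vertices avoiding all three: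
    the exponent is [3 + 3 * (r - 2)]. *)
Lemma card_induced_shape_ge (r n : nat) : 1 < r -> r.*2 <= n ->
  n ^ (3 * r.-1) <= 2 ^ (3 * r.-1) * (r - 2)`! ^ 3 * #|induced_shape 'I_n r|.
Proof.
move=> r_gt1 n_ge.
pose E (v : {ffun 'I_3 -> 'I_n}) (i : 'I_3) : {set {set 'I_n}} :=
  [set e : {set 'I_n} | [&& #|e| == r,
     v i \in e, v (i + 1)%R \in e & v (i - 1)%R \notin e]]%SET.
have E_ge (v : {ffun 'I_3 -> 'I_n}) i : injective v -> 'C(n - 3, r - 2) <= #|E v i|.
  move=> vinj; pose W := (~: (v @: [set: 'I_3]))%SET.
  have cardW : #|W| = n - 3.
    by rewrite cardsCs setCK card_imset // cardsT !card_ord.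
  have vW (X : {set 'I_n}) j : X \subset W -> v j \notin X.
    move=> /subsetP XW; apply/negP => /XW; rewrite inE imset_f //.
  have v_neq : v i != v (i + 1)%R.
    by rewrite (inj_eq vinj) -subr_eq0 opprD addrA subrr sub0r oppr_eq0.
  pose h (X : {set 'I_n}) := ([set v i; v (i + 1)%R] :|: X)%SET.
  have hK (X : {set 'I_n}) : X \subset W -> (h X :\: [set v i; v (i + 1)%R])%SET = X.
    move=> XW; rewrite /h finset.setDUl finset.setDv finset.set0U.
    apply/setDidPl; rewrite disjoint_sym disjoints_subset; apply/subsetP => x.
    by rewrite !inE => /orP[] /eqP ->; apply: vW.
  have hinj : {in [set X : {set 'I_n} | X \subset W & #|X| == r - 2]%SET &,
      injective h}.
    move=> X Y; rewrite !inE => /andP[XW _] /andP[YW _] XY.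
    by rewrite -(hK X XW) -(hK Y YW) XY.
  rewrite -cardW -cards_draws -(card_in_imset hinj); apply: subset_leq_card.
  apply/subsetP => _ /imsetP[X + ->]; rewrite inE => /andP[XW /eqP Xr].
  have i0 : (i - 1 == i)%R = false.
    by rewrite subr_eq -[X in X == _]addr0 (inj_eq (addrI _)).
  have i1 : (i - 1 == i + 1)%R = false.
    by move: i {v_neq h hK hinj i0}; apply: ord3P.
  rewrite inE; apply/and4P; split.
  - rewrite -(cardsID [set v i; v (i + 1)%R]%SET (h X)) (setIidPr (subsetUl _ _)).
    by rewrite hK // cards2 v_neq Xr; clear -r_gt1; apply/eqP; lia.
  - by rewrite /h !inE eqxx.
  - by rewrite /h !inE eqxx orbT.
  - by rewrite /h !inE !(inj_eq vinj) i0 i1 vW.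
have F_ge : n ^_ 3 * 'C(n - 3, r - 2) ^ 3 <= #|induced_shape 'I_n r|.
  (* For a fixed vertex sequence the admissible edge sequences form a product of the sets
     [E v i]. *)
  apply: leq_trans (_ : \sum_(v : {ffun 'I_3 -> 'I_n} | injectiveb v)
      #|family (fun i => mem (E v i))| <= _); last first.
    rewrite -[leqRHS]sum1_card.
    rewrite (partition_big (fun t : cycle3 'I_n => t.1) (fun v => injectiveb v)) /=.
      apply: leq_sum => v vinj; rewrite sum1dep_card.
      have pair_inj : injective (fun e : {ffun 'I_3 -> {set 'I_n}} => (v, e)).
        by move=> e e' [].
      rewrite -(card_imset _ pair_inj); apply: subset_leq_card.
      apply/subsetP => _ /imsetP[e /familyP eE ->].
      rewrite !inE eqxx vinj andbT; apply/forallP => i.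
      by have := eE i; rewrite inE.
    by move=> t; rewrite inE => /andP[].
  have -> : n ^_ 3 = #|[set v : {ffun 'I_3 -> 'I_n} | injectiveb v]%SET|.
    by rewrite card_inj_ffuns !card_ord.
  rewrite -sum1dep_card big_distrl /=; apply: leq_sum => v /injectiveP vinj.
  rewrite mul1n card_family foldrE big_map big_enum /=.
  have -> : 'C(n - 3, r - 2) ^ 3 = \prod_(i < 3) 'C(n - 3, r - 2).
    by rewrite prod_nat_const card_ord.
  by apply: leq_prod => i _; apply: E_ge.
apply: leq_trans (_ : (2 * (n - r)) ^ (3 * r.-1) <= _).
  by rewrite leq_exp2r //; clear -r_gt1 n_ge; lia.
rewrite expnMn -(mulnA (2 ^ _)) leq_mul2l; apply/orP; right.
apply: leq_trans (leq_mul (leqnn _) F_ge).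
rewrite mulnCA -expnMn (_ : 3 * r.-1 = 3 + (r - 2) * 3); last by clear -r_gt1; lia.
rewrite expnD leq_mul //.
  apply: leq_trans (expn_le_ffact n 3); rewrite leq_exp2r //.
  by clear -r_gt1; lia.
rewrite expnM leq_exp2r //; apply: leq_trans (expn_le_bin _ _).
by rewrite (_ : (n - 3).+1 - (r - 2) = n - r) //; clear -r_gt1 n_ge; lia.
Qed.

(** [S] has order at least [n ^ (3 * r - 4)], and [card_triangles_le] with codegree bound
    [n ^ (r - 2)] gives exponent [r - 2/3] for the edges. *)
Lemma triangles_many (r n : nat) (H : hypergraph 'I_n) (S : {set cycle3 'I_n}) :
  1 < r -> r.*2 <= n -> uniform r H -> S \subset triangles H ->
  #|induced_shape 'I_n r| <= n * (2 ^ r.+2 * #|S|) ->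
  n ^ (3 * r - 2) <=
    (2 ^ (3 * r.-1) * (r - 2)`! ^ 3 * 2 ^ r.+2) ^ 2 * (r ^ 2) ^ 3 *
    #|(\bigcup_(t in S) triangle_edges t)%SET| ^ 3.
Proof.
move=> r_gt1 n_ge Hr /subsetP St Sbig; set P := (\bigcup_(_ in _) _)%SET.
have n_gt0 : 0 < n by clear -r_gt1 n_ge; lia.
set c := 2 ^ (3 * r.-1) * (r - 2)`! ^ 3 * 2 ^ r.+2.
have nS : n ^ (3 * r - 4) <= c * #|S|.
  rewrite -(leq_pmul2l n_gt0) -expnS (_ : (3 * r - 4).+1 = 3 * r.-1); last first.
    by clear -r_gt1; lia.
  apply: leq_trans (card_induced_shape_ge r_gt1 n_ge) _.
  by rewrite /c -(mulnA (2 ^ (3 * r.-1) * _)) [leqRHS]mulnCA leq_mul2l Sbig orbT.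
have S_le : #|S| ^ 2 <= (n ^ (r - 2)) ^ 3 * (r ^ 2 * #|P|) ^ 3.
  rewrite -[n in X in _ <= X * _]card_ord; apply: card_triangles_le => [e|t tS].
    case/bigcupP => t tS /imsetP[i _ ->]; apply/eqP; have /forall_inP := Hr; apply.
    by have := St t tS; rewrite inE => /and4P[_ _ /forallP].
  have := St t tS; rewrite inE => /and4P[/injectiveP tinj _ _ /forallP tP].
  split=> // i; rewrite tP andbT; apply/bigcupP; exists t => //; exact: imset_f.
(* Multiplying by this power cancels the codegree factor of [S_le]. *)
have pos : 0 < n ^ ((r - 2) * 3) by rewrite expn_gt0 n_gt0.
rewrite -(leq_pmul2l pos) -expnD.
rewrite (_ : (r - 2) * 3 + (3 * r - 2) = (3 * r - 4) * 2); last first.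
  by clear -r_gt1; lia.
rewrite expnM; apply: leq_trans (_ : (c * #|S|) ^ 2 <= _); first by rewrite leq_exp2r.
rewrite [leqRHS]mulnCA -mulnA expnMn leq_mul2l; apply/orP; right.
by apply: leq_trans S_le _; rewrite expnM expnMn mulnCA.
Qed.

(** Sandwiching [target] between the induced and all triangles treats both problems at once: induced
    shapes ensure many objects, and the extremal bound holds for all triangles. *)
Lemma requires_rounds_triangles (R : realType) (r : nat) (r_gt0 : 0 < r)
    (B : nat -> nat) (M : model)
    (target : forall n, hypergraph 'I_n -> {set cycle3 'I_n}) :
  1 < r ->
  (fun n => (B n)%:R%R : R^o) \is 'Theta_\oo (fun n => ln n%:R%R : R^o) ->
  (forall n (H : hypergraph 'I_n), induced_triangles H \subset target n H) ->
  (forall n (H : hypergraph 'I_n), target n H \subset triangles H) ->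
  requires_rounds M B (fun n => uniform_dist R 'I_n r_gt0)
    (1 - (2 ^ r.+3)%:R^-1)%R target
    (fun n => n%:R `^ (r%:R - 5 / 3) / ln n%:R)%R.
Proof.
move=> r_gt1 Btheta ind_target target_tri.
have c_gt0 : 0 < (2 ^ (3 * r.-1) * (r - 2)`! ^ 3 * 2 ^ r.+2) ^ 2 * (r ^ 2) ^ 3.
  by rewrite !(muln_gt0, expn_gt0) fact_gt0 r_gt0.
(* Three edges suffice, but [k = r.+1] gives the same success probability as for simplices. *)
refine (@requires_rounds_uniform R r r_gt0 B M _ target
  (fun n => induced_shape 'I_n r) (fun n => @triangle_edges 'I_n)
  r.+1 3 (3 * r - 2) _ r.*2 _ r_gt1 isT c_gt0 _ _ Btheta _ _ _ _ _).
- by clear -r_gt1; lia.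
- by rewrite natrB ?natrM; [lra|clear -r_gt1; lia].
- move=> n n_ge; have := card_induced_shape_ge r_gt1 n_ge.
  case: #|_| => [|//]; rewrite muln0 leqn0 expn_eq0.
  by clear -r_gt1 n_ge; lia.
- move=> n t; rewrite inE => /andP[_ /forallP tP]; split.
    by apply: leq_trans (leq_imset_card _ _) _; rewrite card_ord.
  by apply/subsetP => _ /imsetP[i _ ->]; rewrite inE; have /and4P[] := tP i.
- move=> n H t _ tF tH; apply: (subsetP (ind_target n H)).
  exact: induced_shapeP tF tH.
- move=> n H t _ /(subsetP (target_tri n H)); rewrite inE => /and4P[_ _ /forallP tH _].
  by apply/subsetP => _ /imsetP[i _ ->]; apply: tH.
- move=> n H S n_ge Hr St.
  exact: triangles_many n_ge Hr (fintype.subset_trans St (target_tri n H)).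
Qed.

Lemma requires_rounds_simplices (R : realType) (r : nat) (r_gt0 : 0 < r)
    (B : nat -> nat) (M : model) :
  1 < r ->
  (fun n => (B n)%:R%R : R^o) \is 'Theta_\oo (fun n => ln n%:R%R : R^o) ->
  requires_rounds M B (fun n => uniform_dist R 'I_n r_gt0)
    (1 - (2 ^ r.+3)%:R^-1)%R (fun n => @simplices 'I_n r)
    (fun n => n%:R `^ (r%:R - 2 + (r%:R + 1)^-1) / ln n%:R)%R.
Proof.
move=> r_gt1 Btheta.
have c_gt0 : 0 < (2 ^ r.+1 * (r.+1)`! * 2 ^ r.+2) ^ r.
  by rewrite !(muln_gt0, expn_gt0) fact_gt0.
(* Here [k = r.+1] is the number of facets, and [r * r] exceeds [r.+1 * r.-1] by exactly 1. *)
refine (@requires_rounds_uniform R r r_gt0 B M _ (fun n => @simplices 'I_n r)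
  (fun n => ksets 'I_n r.+1) (fun n => @simplex_facets 'I_n r)
  r.+1 r.+1 (r * r) _ r.*2 _ r_gt1 (ltn0Sn r) c_gt0 _ _ Btheta _ _ _ _ _).
- by clear -r_gt1; nia.
- rewrite natrM -(natr1 r); field.
  by rewrite natr1 pnatr_eq0.
- move=> n n_ge; have := card_ksets_ge n_ge r_gt0.
  case: #|_| => [|//]; rewrite muln0 leqn0 expn_eq0.
  by clear -r_gt1 n_ge; lia.
- move=> n S; rewrite inE => /eqP Sr; split.
    by rewrite /simplex_facets cards_draws Sr binSn.
  by apply/subsetP => e; rewrite !inE => /andP[].
- move=> n H S _; rewrite !inE => SF /subsetP SH; rewrite /is_simplex SF /=.
  by apply/forallP => e; apply/implyP => eS; apply: SH; rewrite inE.
- move=> n H S _; rewrite inE => /andP[_ /forallP SH]; apply/subsetP => e.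
  by rewrite inE; apply/implyP.
- by move=> n H S n_ge Hr St; apply: (simplices_many r_gt0 n_ge Hr St).
Qed.

End Instances.

Theorem theorem13 (R : realType) (r : nat) (r_ge2 : (2 <= r)%N) :
  exists D : forall n : nat, fdist R (hypergraph 'I_n),
    (forall (n : nat) (H : hypergraph 'I_n), 0 < D n H -> uniform r H) /\
    exists2 p : R, 0 < p < 1 &
      forall B : nat -> nat,
        (fun n => (B n)%:R : R^o) \is 'Theta_\oo (fun n => ln n%:R : R^o) ->
      forall M : model,
        [/\ requires_rounds M B D p (fun n => @simplices 'I_n r)
              (fun n => n%:R `^ (r%:R - 2 + (r%:R + 1)^-1) / ln n%:R),
            requires_rounds M B D p (fun n => @triangles 'I_n)
              (fun n => n%:R `^ (r%:R - 5 / 3) / ln n%:R)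
          & requires_rounds M B D p (fun n => @induced_triangles 'I_n)
              (fun n => n%:R `^ (r%:R - 5 / 3) / ln n%:R)].
Proof.
have r_gt0 : (0 < r)%N := ltnW r_ge2.
exists (fun n => uniform_dist R 'I_n r_gt0); split.
  by move=> n H /=; case: ifP => //; rewrite ltxx.
(* The general threshold [1 - 2 ^- k.+2] at [k = r.+1]. *)
exists (1 - (2 ^ r.+3)%:R^-1).
  rewrite subr_gt0 invf_lt1 ?ltr1n ?ltr0n ?expn_gt0 // -[X in (X < _)%N](expn0 2).
  by rewrite ltn_exp2l //= gtrBl invr_gt0 ltr0n expn_gt0.
move=> B Btheta M; split.
- exact: requires_rounds_simplices.
- apply: requires_rounds_triangles => // n H.
  by apply/subsetP => t; rewrite !inE => /andP[].
- apply: requires_rounds_triangles => // n H.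
  by apply/subsetP => t; rewrite !inE => /andP[].
Qed.
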